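(* Let $F,S\in\mathcal{C}(I,\mathcal{K}_c(\mathbb{R}))$ be Lipschitz functions such that $S(u_1)-F(u_1)=S(u_N)-F(u_N)$, and let $\alpha\in(-1,1)$. Let $F^\alpha$ be the $\alpha$-fractal function corresponding to $F$. Then $\dim_H(\mathcal{G}(F^{\alpha}))=1$ provided that $|\alpha|<a:=\min\{a_j:j\in J\}$.
   Context: $\mathcal{K}(\mathbb{R})$ is the collection of nonempty compact subsets of $\mathbb{R}$, with the Hausdorff metric $H_d$; $\mathcal{K}_c(\mathbb{R})$ is the subcollection of convex ones. For sets $A,B$ and $\lambda\in\mathbb{R}$: $A+B=\{a+b\}$ (Minkowski sum), $\lambda A=\{\lambda a\}$, $A-B=\{a-b:a\in A,b\in B\}$. $\mathcal{C}(I,\mathcal{K}_c(\mathbb{R}))$ is the set of continuous maps. Setting: $I=[u_1,u_N]$ with partition $\Delta: u_1<\cdots<u_N$, $J=\{1,\ldots,N-1\}$, $I_j=[u_j,u_{j+1}]$, and $L_j:I\to I_j$ is the affine contraction $L_j(u)=a_ju+b_j$ with $L_j(u_1)=u_j$, $L_j(u_N)=u_{j+1}$, so $a_j=\frac{u_{j+1}-u_j}{u_N-u_1}\in(0,1)$. $F^\alpha$ is the unique continuous map $I\to\mathcal{K}(\mathbb{R})$ with $F^{\alpha}(u)=F(u)+\alpha[F^{\alpha}(L_j^{-1}(u))-S(L_j^{-1}(u))]$ for every $u\in I_j$, $j\in J$. The graph is $\mathcal{G}(F^\alpha)=\{(u,F^\alpha(u)):u\in I\}\subset I\times\mathcal{K}(\mathbb{R})$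 with metric $D_{\mathcal{G}}((u,F^\alpha(u)),(w,F^\alpha(w)))=|u-w|+H_d(F^\alpha(u),F^\alpha(w))$; $\dim_H$ is the Hausdorff dimension with respect to $D_{\mathcal{G}}$. *)

(* Defs.v *)
From HB Require Import structures.
From mathcomp Require Import all_boot all_order all_algebra.
From mathcomp Require Import all_classical all_reals all_analysis.

Set Implicit Arguments.
Unset Strict Implicit.
Unset Printing Implicit Defensive.

Import Order.TTheory GRing.Theory Num.Theory.
Import numFieldNormedType.Exports.

Local Open Scope classical_set_scope.
Local Open Scope ring_scope.

Section minkowski.
Context {R : realType}.
Implicit Types A B : set R.

Definition mink_add A B : set R := [set a + b | a in A & b in B].
(* Elementwise difference, not an inverse of [mink_add]. *)
Definition mink_sub A B : set R := [set a - b | a in A & b in B].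
Definition mink_scale (k : R) A : set R := [set k * a | a in A].

End minkowski.

Record compacts (R : realType) := Compacts {
  cset :> set R ;
  cset_neq0 : cset !=set0 ;
  cset_compact : compact cset }.

Section hausdorff_metric.
Context {R : realType}.
Implicit Types (A B C : compacts R) (x y : R).

Definition setdist x (A : set R) : R := inf [set `|x - y| | y in A].

Definition excess (A B : set R) : R := sup [set setdist x B | x in A].

Definition hdist A B : R := Num.max (excess A B) (excess B A).

Lemma setdist_ge0 x A : 0 <= setdist x A.
Proof.
apply: lb_le_inf; last by move=> _ [y _ <-].
by have [y Ay] := cset_neq0 A; exists `|x - y|, y.
Qed.

Lemma setdist_le x y A : cset A y -> setdist x A <= `|x - y|.
Proof. by move=> Ay; apply: ge_inf; [exists 0 => _ [z _ <-]|exists y]. Qed.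

Lemma le_setdist x r A : (forall y, cset A y -> r <= `|x - y|) ->
  r <= setdist x A.
Proof.
move=> h; apply: lb_le_inf; last by move=> _ [y Ay <-]; exact: h.
by have [y Ay] := cset_neq0 A; exists `|x - y|, y.
Qed.

Lemma excess_has_sup A B : has_sup [set setdist x B | x in cset A].
Proof.
split; first by have [y Ay] := cset_neq0 A; exists (setdist y B), y.
have [b Bb] := cset_neq0 B.
have [M [_ hM]] := compact_bounded (@cset_compact _ A).
exists (M + 1 + `|b|) => _ [x Ax <-].
apply: (le_trans (setdist_le x Bb)); apply: (le_trans (ler_normB _ _)).
by rewrite lerD2r; apply: hM => //; rewrite ltrDl.
Qed.

Lemma setdist_excess x A B : cset A x -> setdist x B <= excess A B.
Proof.
by move=> Ax; apply: ub_le_sup; [exact: (excess_has_sup A B).2|exists x].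
Qed.

Lemma excess_le A B r : (forall x, cset A x -> setdist x B <= r) ->
  excess A B <= r.
Proof.
move=> h; apply: ge_sup; first exact: (excess_has_sup A B).1.
by move=> _ [x Ax <-]; exact: h.
Qed.

Lemma excess_ge0 A B : 0 <= excess A B.
Proof.
have [x Ax] := cset_neq0 A.
exact: le_trans (setdist_ge0 x B) (setdist_excess B Ax).
Qed.

Lemma excess_triangle B A C : excess A C <= excess A B + excess B C.
Proof.
apply: excess_le => x Ax; rewrite -lerBlDr.
apply: le_trans (setdist_excess B Ax); apply: le_setdist => y By.
rewrite lerBlDr -lerBlDl; apply: le_trans (setdist_excess C By).
apply: le_setdist => z Cz; rewrite lerBlDl.
apply: le_trans (setdist_le x Cz) _.
by rewrite -(subrKA y x) ler_normD.
Qed.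

Lemma excess_eq0 A B : excess A B = 0 -> cset A `<=` cset B.
Proof.
move=> h x Ax; have cB : closed (cset B).
  by apply: compact_closed; [exact: Rhausdorff|exact: cset_compact].
apply: cB => V /nbhs_ballP[e /= e0 eV].
have [y By xy] : exists2 y, cset B y & `|x - y| < e.
  have [|_ [y By <-] ye] := @inf_adherent _ [set `|x - y| | y in cset B] e e0.
    split; last by exists 0 => _ [y _ <-].
    by have [y By] := cset_neq0 B; exists `|x - y|, y.
  exists y => //; apply: lt_le_trans ye _.
  by rewrite gerDr -h; exact: setdist_excess.
by exists y; split => //; exact: eV.
Qed.

Lemma compacts_eq A B : cset A = cset B -> A = B.
Proof.
case: A B => [A A0 cA] [B B0 cB] /= AB; rewrite -AB in B0 cB *.
by congr Compacts; exact: Prop_irrelevance.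
Qed.

Lemma hdistxx A : hdist A A = 0.
Proof.
rewrite /hdist maxxx; apply/le_anti; rewrite excess_ge0 andbT.
by apply: excess_le => x Ax; rewrite (le_trans (setdist_le x Ax))// subrr normr0.
Qed.

Lemma hdist_positivity A B : hdist A B = 0 -> A = B.
Proof.
move=> h; apply: compacts_eq; apply/seteqP; split; apply: excess_eq0;
  apply/le_anti; rewrite excess_ge0 andbT -h /hdist le_max lexx ?orbT//.
Qed.

Lemma hdist_sym A B : hdist A B = hdist B A.
Proof. by rewrite /hdist maxC. Qed.

Lemma hdist_triangle B A C : hdist A C <= hdist A B + hdist B C.
Proof.
rewrite {1}/hdist ge_max; apply/andP; split.
- apply: le_trans (excess_triangle B A C) _.
  by apply: lerD; rewrite /hdist le_max lexx.
- apply: le_trans (excess_triangle B C A) _.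
  by rewrite addrC; apply: lerD; rewrite /hdist le_max lexx orbT.
Qed.

End hausdorff_metric.

HB.instance Definition _ (R : realType) := gen_eqMixin (compacts R).
HB.instance Definition _ (R : realType) := gen_choiceMixin (compacts R).
HB.instance Definition _ (R : realType) := isMetric.Build R (compacts R)
  (@hdistxx R) (@hdist_positivity R) (@hdist_sym R) (@hdist_triangle R).

(* The alias carries the sum metric; the product [R * compacts R] already has
   the max metric of the library. *)
Definition graph_space (R : realType) : Type := (R * compacts R)%type.

Section graph_metric.
Context {R : realType}.
Implicit Types p q r : graph_space R.

Definition gdist p q : R := `|p.1 - q.1| + mdist p.2 q.2.

Lemma gdistxx p : gdist p p = 0.
Proof. by rewrite /gdist subrr normr0 mdistxx addr0. Qed.

Lemma gdist_positivity p q : gdist p q = 0 -> p = q.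
Proof.
move=> /eqP; rewrite paddr_eq0 ?mdist_ge0//.
rewrite normr_eq0 subr_eq0 => /andP[/eqP e1 /eqP/mdist_positivity e2].
by rewrite [p]surjective_pairing [q]surjective_pairing e1 e2.
Qed.

Lemma gdist_sym p q : gdist p q = gdist q p.
Proof. by rewrite /gdist distrC metric_sym. Qed.

Lemma gdist_triangle q p r : gdist p r <= gdist p q + gdist q r.
Proof.
rewrite /gdist addrACA lerD ?metric_triangle//.
by rewrite -(subrKA q.1 p.1) ler_normD.
Qed.

End graph_metric.

HB.instance Definition _ (R : realType) := gen_eqMixin (graph_space R).
HB.instance Definition _ (R : realType) := gen_choiceMixin (graph_space R).
HB.instance Definition _ (R : realType) := isMetric.Build R (graph_space R)
  (@gdistxx R) (@gdist_positivity R) (@gdist_sym R) (@gdist_triangle R).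

Definition graph (R : realType) (I : set R) (G : R -> compacts R) :
  set (graph_space R) := [set (x, G x) | x in I].

Section hausdorff_dimension.
Context {R : realType} {T : metricType R}.
Local Open Scope ereal_scope.
Implicit Types (E U : set T) (s d : R).

(* 0 is added so that the empty set has diameter 0 instead of -oo. *)
Definition diam U : \bar R :=
  ereal_sup (0 |` [set (mdist x y)%:E | x in U & y in U]).

(* The case split matters for s = 0 only, where 0 `^ 0 = 1. *)
Definition diam_pow s U : \bar R :=
  if U == set0 then 0 else poweR (diam U) s.

Definition hausdorff_premeasure s d E : \bar R :=
  ereal_inf [set \sum_(0 <= i <oo) diam_pow s (U i) |
    U in [set U : nat -> set T |
      E `<=` \bigcup_i U i /\ forall i, diam (U i) <= d%:E]].

Definition hausdorff_measure s E : \bar R :=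
  ereal_sup [set hausdorff_premeasure s d E | d in [set d | (0 < d)%R]].

Definition hausdorff_dim E : \bar R :=
  ereal_inf [set s%:E | s in [set s | (0 <= s)%R /\ hausdorff_measure s E = 0]].

End hausdorff_dimension.

Definition lipschitz_within (R : realType) (T : metricType R) (I : set R)
    (F : R -> T) : Prop :=
  exists k : R, forall x y, I x -> I y -> mdist (F x) (F y) <= k * `|x - y|.

(* Maps on I are represented by total functions; their values outside I are
   irrelevant. *)
Definition continuous_convex (R : realType) (I : set R) (F : R -> compacts R)
    : Prop :=
  {within I, continuous F} /\
  forall x, I x -> convex_set (cset (F x) : set R^o).

Section fractal.
Context {R : realType}.
Variables (u : nat -> R) (N : nat).

(* The nodes are u 1, ..., u N; the other values of u are irrelevant. *)
Definition domain : set R := `[u 1%N, u N]%classic.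

Definition subdomain (j : nat) : set R := `[u j, u j.+1]%classic.

Definition slope (j : nat) : R := (u j.+1 - u j) / (u N - u 1%N).

Definition offset (j : nat) : R := u j - slope j * u 1%N.

Definition contr (j : nat) (x : R) : R := slope j * x + offset j.

Definition contr_inv (j : nat) (x : R) : R := (x - offset j) / slope j.

(* [slope 1] is one of the terms, hence this is the minimum for N >= 2. *)
Definition min_slope : R := \big[Num.min/slope 1]_(1 <= j < N) slope j.

Lemma contr_first j : contr j (u 1%N) = u j.
Proof. by rewrite /contr /offset addrC subrK. Qed.

Lemma contr_last j : u 1%N != u N -> contr j (u N) = u j.+1.
Proof.
move=> u1N; rewrite /contr /offset addrCA -mulrBr /slope divfK ?subrKC//.
by rewrite subr_eq0 eq_sym.
Qed.

Lemma contrK j : slope j != 0 -> cancel (contr j) (contr_inv j).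
Proof. by move=> s0 x; rewrite /contr_inv /contr addrK mulrAC divff ?mul1r. Qed.

Lemma contr_invK j : slope j != 0 -> cancel (contr_inv j) (contr j).
Proof. by move=> s0 x; rewrite /contr_inv /contr mulrC divfK ?subrK. Qed.

Definition alpha_fractal (F S : R -> compacts R) (alpha : R)
    (G : R -> compacts R) : Prop :=
  {within domain, continuous G} /\
  forall j x, (1 <= j < N)%N -> subdomain j x ->
    cset (G x) = mink_add (F x)
      (mink_scale alpha (mink_sub (G (contr_inv j x)) (S (contr_inv j x)))).

End fractal.

(* Main.v *)
Require Import Defs.
From HB Require Import structures.
From mathcomp Require Import all_boot all_order all_algebra.
From mathcomp Require Import all_classical all_reals all_analysis.
From mathcomp Require Import lra ring.

(** The graph of [Falpha] has dimension 1 because [Falpha] is Lipschitz: the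
    graph is then a bi-Lipschitz copy of a nondegenerate interval.

    The Minkowski operations are compatible with the Hausdorff metric
    ([mdist_mink]), so on each piece [u j, u j.+1] the functional equation gives
    d(G x, G y) <= C |x - y| + |alpha| d(G x', G y'), where x', y' are the
    preimages of x, y under the contraction of that piece. Since
    |x' - y'| <= |x - y| / a with a the least slope, the error of a K-Lipschitz
    bound is reproduced with a factor |alpha| < 1, provided that
    C + (|alpha| / a) K <= K; such a K exists because |alpha| / a < 1.
    This is the maximum principle [self_similar_bound].

    The recursion breaks when x and y lie in different pieces, and splitting at
    a node naively would double the error at each step. The way out is to treat
    pairs with one point a node first: the endpoints u 1 and u N are fixed
    points of the first and the last contraction, so the principle applies to
    the pairs (x, u 1) and to the pairs (x, u N); one application of the
    functional equation carries these bounds to both sides of every node, and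
    points of different pieces are then joined through nodes with no recursion
    at all ([lipschitz_across_nodes]).

    For the dimension, the first projection does not increase distances, so a
    cover of the graph with small sum of diameters would cover the interval by
    sets of small total Lebesgue measure ([graph_dim_ge1]); conversely, covering
    the domain by n intervals of length O(1/n) gives a cover of the graph by n
    sets of diameter O(1/n), and n (c/n)^s tends to 0 for each s > 1 ([lipschitz_graph_dim_le1]). *)

Set Implicit Arguments.
Unset Strict Implicit.
Unset Printing Implicit Defensive.

Import Order.TTheory GRing.Theory Num.Theory.
Import numFieldNormedType.Exports.

Local Open Scope classical_set_scope.
Local Open Scope ring_scope.

(** * Functions with values in a metric space *)

Section metric_valued_functions.
Context {R : realType} {T : metricType R}.

Lemma lipschitz_within_nonneg (I : set R) (F : R -> T) :
  lipschitz_within I F ->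
  exists2 k : R, 0 <= k &
    forall x y, I x -> I y -> mdist (F x) (F y) <= k * `|x - y|.
Proof.
move=> [k Fk]; exists (Num.max 0 k); first by rewrite le_max lexx.
move=> x y Ix Iy; apply: le_trans (Fk x y Ix Iy) _.
by rewrite ler_wpM2r// le_max lexx orbT.
Qed.

Lemma continuous_mdist (p : T) : continuous (fun q => mdist p q : R).
Proof.
move=> q; apply/cvgrPdist_lt => e e0.
have : nbhs q (ball q e) by exact: nbhsx_ballx.
apply: filterS => r; rewrite ballEmdist/= => qr.
have h1 := metric_triangle p q r; have h2 := metric_triangle p r q.
rewrite (metric_sym r) in h2.
by apply: le_lt_trans qr; rewrite ler_norml; apply/andP; split; lra.
Qed.

(** This is where the continuity of the fractal function enters: it provides the
    a priori bound that the maximum principle starts from. *)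
Lemma continuous_bounded_within (a b : R) (G : R -> T) : a <= b ->
  {within `[a, b], continuous G} ->
  exists M, forall x y, `[a, b]%classic x -> `[a, b]%classic y ->
    mdist (G x) (G y) <= M.
Proof.
move=> ab Gc.
have fc : {within `[a, b], continuous (fun x => mdist (G a) (G x) : R)}.
  by move=> x; apply: continuous_comp; [exact: Gc|exact: continuous_mdist].
have [c _ fcmax] := EVT_max ab fc.
exists (mdist (G a) (G c) + mdist (G a) (G c)) => x y Ix Iy.
apply: le_trans (metric_triangle _ (G a) _) _.
by rewrite (metric_sym (G x)); apply: lerD; exact: fcmax.
Qed.

End metric_valued_functions.

(** * Hausdorff dimension of graphs over an interval *)

Section hausdorff_dimension_of_graphs.
Context {R : realType}.

Section diameter.
Context {T : metricType R}.
Implicit Types U : set T.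
Local Open Scope ereal_scope.

Lemma diam_ge0 U : 0 <= diam U.
Proof. by apply: ereal_sup_ubound; left. Qed.

Lemma mdist_le_diam U x y : U x -> U y -> (mdist x y)%:E <= diam U.
Proof. by move=> Ux Uy; apply: ereal_sup_ubound; right; exists x => //; exists y. Qed.

Lemma diam_le U (r : R) : (0 <= r)%R ->
  (forall x y, U x -> U y -> (mdist x y <= r)%R) -> diam U <= r%:E.
Proof.
move=> r0 Ur; apply: ge_ereal_sup => _ [->|[x Ux [y Uy <-]]]; rewrite lee_fin//.
exact: Ur.
Qed.

Lemma diam_pow_ge0 s U : 0 <= diam_pow s U.
Proof. by rewrite /diam_pow; case: ifP => // _; exact: poweR_ge0. Qed.

Lemma diam_pow_le s U (r : R) : (0 <= s)%R -> diam U <= r%:E ->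
  diam_pow s U <= (r `^ s)%:E.
Proof.
move=> s0 Ur; rewrite /diam_pow; case: ifP => _; first by rewrite lee_fin powR_ge0.
rewrite -poweR_EFin gt0_ler_poweR// in_itv/= leey andbT ?diam_ge0//.
exact: le_trans (diam_ge0 U) Ur.
Qed.

(** For sets of diameter at most 1, lowering the exponent below 1 increases the
    sums, so the lower bound for the dimension only has to deal with [s = 1]. *)
Lemma diam_le_diam_pow s U : (s <= 1)%R -> diam U <= 1 ->
  diam U <= diam_pow s U.
Proof.
move=> s1; rewrite /diam_pow; case: ifPn => [/eqP -> _|_].
  exact: diam_le.
case: (diam U) (diam_ge0 U) => [d| |]//; rewrite poweR_EFin !lee_fin.
rewrite le_eqVlt => /predU1P[<- _|d0 d1]; first exact: powR_ge0.
by apply: ger1_powR => //; rewrite d0.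
Qed.

Lemma hausdorff_measure_eq0 s (E : set T) :
  (forall d e : R, (0 < d)%R -> (0 < e)%R ->
    hausdorff_premeasure s d E <= e%:E) ->
  hausdorff_measure s E = 0.
Proof.
move=> H; apply/le_anti/andP; split.
  apply: ge_ereal_sup => _ [d /= d0 <-].
  by apply/lee_addgt0Pr => e e0; rewrite add0e H.
apply: le_ereal_sup_tmp; exists (hausdorff_premeasure s 1 E).
  by exists 1%R => //=.
apply: le_ereal_inf_tmp => _ [U _ <-].
by apply: nneseries_ge0 => i _ _; exact: diam_pow_ge0.
Qed.

End diameter.

(** The projection of a set of diameter [d] is contained in the interval of
    radius [d] around the projection of any of its points, hence the factor 2. *)
Lemma graph_piece_cover s (U : set (graph_space R)) :
  s <= 1 -> (diam U <= 1)%E ->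
  exists J : set R, [/\ measurable J, (forall p, U p -> J p.1) &
    (lebesgue_measure J <= 2%:E * diam_pow s U)%E].
Proof.
move=> s1 U1; have [->|/set0P[p Up]] := eqVneq U set0.
  exists set0; split => //; rewrite measure0.
  by apply: mule_ge0 => //; exact: diam_pow_ge0.
have /fineK dE : diam U \is a fin_num.
  by rewrite ge0_fin_numE ?diam_ge0// (le_lt_trans U1)// ltry.
set d := fine (diam U) in dE.
have d0 : 0 <= d by apply: fine_ge0; exact: diam_ge0.
exists `[p.1 - d, p.1 + d]%classic; split=> //.
- move=> q Uq; have := mdist_le_diam Up Uq; rewrite -dE lee_fin => pq.
  have : `|p.1 - q.1| <= d.
    by apply: le_trans pq; rewrite /mdist/= /gdist lerDl mdist_ge0.
  by rewrite /= in_itv/= ler_norml => /andP[? ?]; apply/andP; split; lra.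
- rewrite lebesgue_measure_itv/=; case: ifP => _; last first.
    by apply: mule_ge0 => //; exact: diam_pow_ge0.
  apply: (@le_trans _ _ (2%:E * diam U)%E); last first.
    by rewrite lee_pmul2l//; exact: diam_le_diam_pow.
  by rewrite -dE -EFinB -EFinM lee_fin; lra.
Qed.

(** If the [s]-dimensional measure vanished for some [s < 1], the graph would
    have a cover whose projection has total length less than [b - a]. *)
Lemma graph_dim_ge1 (a b : R) (G : R -> compacts R) : a < b ->
  (1%:E <= hausdorff_dim (graph `[a, b] G))%E.
Proof.
move=> ab; apply: le_ereal_inf_tmp => _ [s /= [s0 Hs] <-].
rewrite lee_fin leNgt; apply/negP => /ltW s1.
have : (hausdorff_premeasure s 1 (graph `[a, b] G) < ((b - a) / 2)%:E)%E.
  apply: (@le_lt_trans _ _ 0%E); last by rewrite lte_fin divr_gt0// subr_gt0.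
  by rewrite -Hs; apply: ereal_sup_ubound; exists 1 => //=.
move=> /ereal_inf_lt[_ [U [GU U1] <-]] sumU.
have [J HJ] := choice (fun i => graph_piece_cover s1 (U1 i)).
have : (lebesgue_measure (`[a, b]%classic : set R)
   <= \sum_(0 <= i <oo) lebesgue_measure (J i))%E.
  apply: measure_sigma_subadditive => //.
    by move=> i; case: (HJ i).
  move=> x abx; have [|i _ Uix] := GU (x, G x); first by exists x.
  by exists i => //; case: (HJ i) => _ /(_ _ Uix).
apply/negP; rewrite -ltNge.
apply: (@le_lt_trans _ _ (\sum_(0 <= i <oo) 2%:E * diam_pow s (U i))%E).
  by apply: lee_nneseries => // i _; case: (HJ i).
rewrite nneseriesZl; last by move=> i _; exact: diam_pow_ge0.
rewrite lebesgue_measure_itv/= lte_fin ab -EFinB.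
have -> : (b - a)%:E = (2%:E * ((b - a) / 2)%:E)%E.
  by rewrite -EFinM mulrC divfK.
by rewrite lte_pmul2l.
Qed.

(** The factor 2 in the step makes the right endpoint [b] an interior point of
    the region covered by the [n] intervals, so that it needs no special case. *)
Lemma partition_index (a b x : R) (n : nat) : (0 < n)%N -> a < b ->
  a <= x <= b -> exists2 i, (i < n)%N &
    a + i%:R * (2 * (b - a) / n%:R) <= x <= a + i.+1%:R * (2 * (b - a) / n%:R).
Proof.
move=> n0 ab /andP[ax xb]; set h := 2 * (b - a) / n%:R.
have n0R : 0 < n%:R :> R by rewrite ltr0n.
have h0 : 0 < h by rewrite divr_gt0// mulr_gt0// subr_gt0.
have xh0 : 0 <= (x - a) / h by rewrite divr_ge0 ?subr_ge0// ltW.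
have hn : n%:R * h = 2 * (b - a) by rewrite mulrC divfK ?gt_eqF.
exists (Num.truncn ((x - a) / h)).
  rewrite truncn_lt_nat// ltr_pdivrMr// hn.
  by move: ab ax xb; lra.
have := truncn_itv xh0; rewrite ler_pdivlMr// ltr_pdivrMr//.
by move=> /andP[? ?]; apply/andP; split; lra.
Qed.

(** Since [n * (c / n) ^ s = c * (c / n) ^ (s - 1)], it suffices that [c / n] is
    at most [(e / c) ^ (1 / (s - 1))]. *)
Lemma fine_enough (c d e s : R) : 0 < c -> 0 < d -> 0 < e -> 1 < s ->
  exists n : nat, [/\ (0 < n)%N, c / n%:R <= d & n%:R * (c / n%:R) `^ s <= e].
Proof.
move=> c0 d0 e0 s1.
have ec0 : 0 < e / c by rewrite divr_gt0.
set t := (e / c) `^ (s - 1)^-1.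
have t0 : 0 < t by exact: powR_gt0.
set m := Num.min d t; have m0 : 0 < m by rewrite lt_min d0.
exists (Num.truncn (c / m)).+1; set n := (Num.truncn (c / m)).+1.
have n0 : 0 < n%:R :> R by rewrite ltr0n.
have cnm : c / n%:R <= m.
  rewrite ler_pdivrMr// mulrC -ler_pdivrMr//.
  exact/ltW/truncnS_gt.
have cn0 : 0 < c / n%:R by rewrite divr_gt0.
split=> //; first by apply: le_trans cnm _; rewrite ge_min lexx.
have s10 : 0 < s - 1 by rewrite subr_gt0.
rewrite -mulr_powRB1 ?(ltW cn0)//; last exact: lt_trans s1.
rewrite mulrA (mulrC n%:R) divfK ?gt_eqF// -ler_pdivlMl// [leRHS]mulrC.
apply: (@le_trans _ _ (t `^ (s - 1))).
  apply: ge0_ler_powR; rewrite ?nnegrE ?(ltW s10) ?(ltW cn0) ?(ltW t0)//.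
  by apply: le_trans cnm _; rewrite ge_min lexx orbT.
by rewrite -powRrM mulVf ?gt_eqF// powRr1// ltW.
Qed.

(** Over an interval of length [h], the sum metric gives the graph a diameter of
    at most [h + k * h]. *)
Lemma lipschitz_graph_dim_le1 (a b : R) (G : R -> compacts R) : a < b ->
  lipschitz_within `[a, b] G ->
  (hausdorff_dim (graph `[a, b] G) <= 1%:E)%E.
Proof.
move=> ab /lipschitz_within_nonneg[k k_ge0 Gk].
apply/lee_addgt0Pr => e e0; rewrite -EFinD.
apply: ereal_inf_lbound; exists (1 + e) => //; split; first by lra.
set s := 1 + e; have s1 : 1 < s by rewrite ltrDl.
apply: hausdorff_measure_eq0 => d r d0 r0.
have c0 : 0 < (1 + k) * (2 * (b - a)).
  by rewrite mulr_gt0 ?ltr_wpDr// mulr_gt0// subr_gt0.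
have [n [n0 cnd cnr]] := fine_enough c0 d0 r0 s1.
set h := 2 * (b - a) / n%:R.
have h0 : 0 < h by rewrite divr_gt0 ?mulr_gt0 ?subr_gt0 ?ltr0n.
have cnE : (1 + k) * (2 * (b - a)) / n%:R = (1 + k) * h by rewrite [RHS]mulrA.
rewrite cnE in cnd cnr.
pose U i : set (graph_space R) := if (i < n)%N then
  graph (`[a, b] `&` `[a + i%:R * h, a + i.+1%:R * h]) G else set0.
have Uh i : (diam (U i) <= ((1 + k) * h)%:E)%E.
  apply: diam_le; first by rewrite mulr_ge0 ?(ltW h0)//; lra.
  move=> p p'; rewrite /U; case: ifP => // _ [x [abx Ix] <-] [y [aby Iy] <-].
  have xy : `|x - y| <= h.
    move: Ix Iy; rewrite /= !in_itv/= => /andP[? ?] /andP[? ?].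
    by rewrite ler_norml; apply/andP; split; lra.
  rewrite /mdist/= /gdist/= mulrDl mul1r lerD//.
  by apply: le_trans (Gk _ _ abx aby) _; rewrite ler_wpM2l.
apply: (@le_trans _ _ (\sum_(0 <= i <oo) diam_pow s (U i))%E).
  apply: ereal_inf_lbound; exists U => //; split=> [_ [x abx <-]|i].
    move: (abx); rewrite /= in_itv/= => /(partition_index n0 ab)[i ilt xi].
    exists i => //; rewrite /U ilt; exists x => //; split=> //; rewrite /= in_itv; exact: xi.
  by apply: le_trans (Uh i) _; rewrite lee_fin.
rewrite (nneseries_split _ n); last by move=> i _; exact: diam_pow_ge0.
rewrite add0n eseries0 ?adde0; last first.
  by move=> i ni _; rewrite /U ltnNge ni/= /diam_pow eqxx.
apply: (@le_trans _ _ (\sum_(0 <= i < n) (((1 + k) * h) `^ s)%:E)%E).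
  by apply: lee_sum => i _; apply: diam_pow_le => //; lra.
rewrite sumEFin lee_fin big_const_nat subn0 iter_addr_0 -mulr_natl.
exact: cnr.
Qed.

End hausdorff_dimension_of_graphs.

(** * Minkowski operations and the Hausdorff metric *)

Section minkowski_hausdorff.
Context {R : realType}.
Implicit Types A B F G S : compacts R.

Lemma excess_adherent A B x (e : R) : cset A x -> 0 < e ->
  exists2 y, cset B y & `|x - y| < excess A B + e.
Proof.
move=> Ax e0.
have [|_ [y By <-] ye] := @inf_adherent _ [set `|x - y| | y in cset B] e e0.
  split; last by exists 0 => _ [y _ <-].
  by have [y By] := cset_neq0 B; exists `|x - y|, y.
exists y => //; apply: lt_le_trans ye _.
by rewrite lerD2r; exact: setdist_excess.
Qed.

(** Near-optimal approximations of the three points that build a point of [A]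
    build a point of [A']. *)
Lemma excess_mink (k : R) F G S A F' G' S' A' :
  cset A = mink_add F (mink_scale k (mink_sub G S)) ->
  cset A' = mink_add F' (mink_scale k (mink_sub G' S')) ->
  excess A A' <= excess F F' + `|k| * (excess G G' + excess S S').
Proof.
move=> AE A'E; apply: excess_le => x; rewrite AE.
move=> [f Ff [_ [_ [g Gg [s Ss <-]] <-] <-]].
apply/ler_addgt0Pr => e e0.
have k0 : 0 < 1 + 2 * `|k| by rewrite ltr_wpDr// mulr_ge0.
pose r := e / (1 + 2 * `|k|).
have r0 : 0 < r by rewrite divr_gt0.
(* The total error is one [r] from [F] and [|k|] times two [r] from [G], [S]. *)
have rE : r + `|k| * (r + r) = e.
  by rewrite -[RHS](@divfK _ (1 + 2 * `|k|)) ?gt_eqF// -/r; ring.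
have [f' Ff' ff'] := excess_adherent F' Ff r0.
have [g' Gg' gg'] := excess_adherent G' Gg r0.
have [s' Ss' ss'] := excess_adherent S' Ss r0.
have A'x : cset A' (f' + k * (g' - s')).
  rewrite A'E; exists f' => //; exists (k * (g' - s')) => //.
  by exists (g' - s') => //; exists g' => //; exists s'.
apply: le_trans (setdist_le _ A'x) _.
have -> : f + k * (g - s) - (f' + k * (g' - s')) =
    (f - f') + k * ((g - g') - (s - s')) by ring.
apply: le_trans (ler_normD _ _) _; rewrite normrM -rE addrACA.
apply: lerD; first exact: ltW.
rewrite -mulrDr; apply: ler_wpM2l => //.
by apply: le_trans (ler_normB _ _) _; rewrite addrACA; apply: lerD; exact: ltW.
Qed.

Lemma mdist_mink (k : R) F G S A F' G' S' A' :
  cset A = mink_add F (mink_scale k (mink_sub G S)) ->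
  cset A' = mink_add F' (mink_scale k (mink_sub G' S')) ->
  mdist A A' <= mdist F F' + `|k| * (mdist G G' + mdist S S').
Proof.
move=> AE A'E; rewrite /mdist/= {1}/hdist ge_max; apply/andP; split.
  apply: le_trans (excess_mink AE A'E) _.
  by apply: lerD; rewrite ?ler_wpM2l// ?lerD// le_max lexx.
apply: le_trans (excess_mink A'E AE) _.
by apply: lerD; rewrite ?ler_wpM2l// ?lerD// le_max lexx orbT.
Qed.

End minkowski_hausdorff.

(** * Lipschitz estimates from self-similarity *)

(** A maximum principle. If the defect [D - K * E] had a positive supremum on
    [P], then [step] would bound the defect at every point by [al] times that
    supremum, which is smaller. The bound [M] ensures that the supremum is
    finite, and [C + q * K <= K] makes the terms in [E] cancel. In the
    applications [D] is a distance of values and [E] a distance of arguments. *)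
Lemma self_similar_bound {R : realType} {T : Type} (P : set T) (D E : T -> R)
    (al q C K M : R) :
  0 <= al < 1 -> C + q * K <= K -> 0 <= K -> (forall p, P p -> 0 <= E p) ->
  (forall p, P p -> D p <= M) ->
  (forall p, P p -> D p <= K * E p \/
    exists p', [/\ P p', D p <= C * E p + al * D p' & al * E p' <= q * E p]) ->
  forall p, P p -> D p <= K * E p.
Proof.
move=> /andP[al0 al1] CqK K0 E0 DM step p Pp; rewrite -subr_le0.
set V := [set D p - K * E p | p in P].
have Vsup : has_sup V.
  split; first by exists (D p - K * E p), p.
  exists M => _ [r Pr <-]; rewrite lerBlDr ler_wpDr ?DM//.
  by rewrite mulr_ge0 ?E0.
have Vle r : P r -> D r - K * E r <= sup V.
  by move=> Pr; apply: ub_le_sup; [exact: Vsup.2|exists r].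
apply: le_trans (Vle p Pp) _; rewrite leNgt; apply/negP => V0.
suff : sup V <= al * sup V.
  by apply/negP; rewrite -ltNge gtr_pMl.
apply: ge_sup; first exact: Vsup.1.
move=> _ [r Pr <-]; have [Dr|[r' [Pr' Dr Er]]] := step r Pr.
  by apply: (@le_trans _ _ 0); rewrite ?subr_le0// mulr_ge0// ltW.
apply: le_trans (ler_wpM2l al0 (Vle r' Pr')).
have h1 : K * (al * E r') <= K * (q * E r) by rewrite ler_wpM2l.
have h2 : (C + q * K) * E r <= K * E r by rewrite ler_wpM2r// E0.
by move: Dr h1 h2; rewrite !mulrBr !mulrDl => Dr h1 h2; lra.
Qed.

Section partition.
Context {R : realType} (u : nat -> R) (N : nat).
Hypothesis N1 : (1 < N)%N.
Hypothesis u_lt : forall j, (1 <= j < N)%N -> u j < u j.+1.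

Lemma node_le i j : (1 <= i <= j)%N -> (j <= N)%N -> u i <= u j.
Proof.
elim: j => [|j IHj]; first by case: i.
move=> /andP[i1]; rewrite leq_eqVlt => /predU1P[<-//|ij jN].
apply: le_trans (IHj _ (ltnW jN)) (ltW (u_lt _)); first by rewrite i1.
by rewrite jN (leq_trans i1).
Qed.

Lemma length_gt0 : 0 < u N - u 1%N.
Proof.
rewrite subr_gt0; apply: lt_le_trans (u_lt _) (node_le _ (leqnn N)).
  by rewrite N1.
by rewrite N1.
Qed.

Lemma slope_gt0 j : (1 <= j < N)%N -> 0 < slope u N j.
Proof. by move=> jN; rewrite divr_gt0 ?length_gt0// subr_gt0 u_lt. Qed.

Lemma min_slope_le j : (1 <= j < N)%N -> min_slope u N <= slope u N j.
Proof. by move=> jN; apply: ge_bigmin_seq => //; rewrite mem_index_iota. Qed.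

Lemma min_slope_gap i j : (1 <= i < j)%N -> (j <= N)%N ->
  min_slope u N * (u N - u 1%N) <= u j - u i.
Proof.
move=> /andP[i1 ij] jN; have iN := leq_trans ij jN.
apply: (@le_trans _ _ (u i.+1 - u i)).
  by rewrite -ler_pdivlMr ?length_gt0//; apply: min_slope_le; rewrite i1.
by rewrite lerD2r node_le.
Qed.

Lemma domain_node j : (1 <= j <= N)%N -> domain u N (u j).
Proof.
move=> /andP[j1 jN]; rewrite /domain/= in_itv/=.
by rewrite !node_le// ?j1// leqnn jN (leq_trans j1).
Qed.

Lemma domain_subdomain x : domain u N x ->
  exists2 j, (1 <= j < N)%N & subdomain u j x.
Proof.
rewrite /domain/= in_itv/= => /andP[x1 xN].
have [m mN] : exists2 m, (1 < m <= N)%N & x <= u m by exists N; rewrite ?N1 ?leqnn.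
elim: m mN => // m IHm /andP[m1 mN] xm.
have [xm'|/ltW mx] := leP x (u m); last first.
  by exists m; [rewrite -ltnS m1|rewrite /subdomain/= in_itv/= mx].
have [m2|] := ltnP 1 m; first by apply: IHm => //; rewrite m2 ltnW.
move: m1; rewrite ltnS => m1 m1'.
have mE : m = 1%N by apply/eqP; rewrite eqn_leq m1'.
exists 1%N => //; rewrite /subdomain/= in_itv/= x1.
by move: xm; rewrite mE.
Qed.

Lemma contr_inv_diff j x y : (1 <= j < N)%N ->
  contr_inv u N j x - contr_inv u N j y = (x - y) / slope u N j.
Proof. by move=> jN; rewrite /contr_inv -mulrBl; congr (_ / _); ring. Qed.

Lemma contr_inv_first j : (1 <= j < N)%N -> contr_inv u N j (u j) = u 1%N.
Proof.
by move=> jN; rewrite -[X in contr_inv _ _ _ X](contr_first u N j) contrK// gt_eqF ?slope_gt0.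
Qed.

Lemma contr_inv_last j : (1 <= j < N)%N -> contr_inv u N j (u j.+1) = u N.
Proof.
move=> jN; rewrite -[X in contr_inv _ _ _ X](@contr_last _ u N j).
  by rewrite contrK// gt_eqF ?slope_gt0.
by rewrite lt_eqF// -subr_gt0 length_gt0.
Qed.

Lemma contr_inv_domain j x : (1 <= j < N)%N -> subdomain u j x ->
  domain u N (contr_inv u N j x).
Proof.
move=> jN; rewrite /subdomain /domain/= !in_itv/= => /andP[jx xj].
have s0 := slope_gt0 jN.
rewrite -{1}(contr_inv_first jN) -(contr_inv_last jN).
by rewrite !ler_pM2r ?invr_gt0// !lerD2r jx.
Qed.

(** In this section the functional equation enters only through the inequality
    [G_affine], for values in any metric space. The bound [G_bounded] says that
    [K] is large enough to handle points that are at least as far apart as the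
    shortest piece is long. *)
Section self_affine.
Context {T : metricType R} (G : R -> T) (al C K : R).
Hypothesis al01 : 0 <= al < 1.
Hypothesis al_min : al < min_slope u N.
Hypothesis CK : C + al / min_slope u N * K <= K.
Hypothesis K0 : 0 <= K.
Hypothesis G_bounded : forall x y, domain u N x -> domain u N y ->
  mdist (G x) (G y) <= K * (min_slope u N * (u N - u 1%N)).
Hypothesis G_affine : forall j x y, (1 <= j < N)%N ->
  subdomain u j x -> subdomain u j y ->
  mdist (G x) (G y) <= C * `|x - y| +
    al * mdist (G (contr_inv u N j x)) (G (contr_inv u N j y)).

Local Notation q := (al / min_slope u N).

Let min_slope_gt0 : 0 < min_slope u N.
Proof. by case/andP: al01 => al0 _; exact: le_lt_trans al_min. Qed.

Lemma contr_inv_dist_le j x y : (1 <= j < N)%N ->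
  al * `|contr_inv u N j x - contr_inv u N j y| <= q * `|x - y|.
Proof.
move=> jN; rewrite contr_inv_diff// normrM normfV (gtr0_norm (slope_gt0 jN)).
rewrite -mulrA ler_wpM2l//; first by case/andP: al01.
rewrite mulrC ler_wpM2r// lef_pV2 ?posrE ?slope_gt0//.
exact: min_slope_le.
Qed.

(** [u 1] is fixed by the first contraction, so pairs [(x, u 1)] with [x] in the
    first piece are sent to pairs of the same kind; the other points [x] are far
    from [u 1]. *)
Lemma lipschitz_at_first x : domain u N x ->
  mdist (G x) (G (u 1%N)) <= K * `|x - u 1%N|.
Proof.
have D1 : domain u N (u 1%N) by apply: domain_node; rewrite leqnn ltnW.
apply: (self_similar_bound (D := fun y => mdist (G y) (G (u 1%N)))
  (E := fun y => `|y - u 1%N|) al01 CK K0) => [//|y Dy|y Dy].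
  exact: G_bounded.
have N1' : (1 <= 1 < N)%N by rewrite N1.
move: (Dy); rewrite {1}/domain/= in_itv/= => /andP[y1 yN].
have [y2|/ltW y2] := leP y (u 2%N).
  right; exists (contr_inv u N 1 y).
  have Sy : subdomain u 1 y by rewrite /subdomain/= in_itv/= y1.
  have S1 : subdomain u 1 (u 1%N) by rewrite /subdomain/= in_itv/= lexx ltW// u_lt.
  split; first exact: contr_inv_domain.
    by rewrite -{3}(contr_inv_first N1'); exact: G_affine.
  by rewrite -{1}(contr_inv_first N1'); exact: contr_inv_dist_le.
left; apply: le_trans (G_bounded Dy D1) _; rewrite ler_wpM2l//.
rewrite ger0_norm ?subr_ge0//; apply: (@le_trans _ _ (u 2%N - u 1%N)).
  exact: min_slope_gap.
by rewrite lerD2r.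
Qed.

(** The same for [u N], which is fixed by the last contraction. *)
Lemma lipschitz_at_last x : domain u N x ->
  mdist (G x) (G (u N)) <= K * `|x - u N|.
Proof.
have DN : domain u N (u N) by apply: domain_node; rewrite leqnn ltnW.
apply: (self_similar_bound (D := fun y => mdist (G y) (G (u N)))
  (E := fun y => `|y - u N|) al01 CK K0) => [//|y Dy|y Dy].
  exact: G_bounded.
have [n nE] : exists n, N = n.+1 by case: N N1 => // n _; exists n.
have nN : (1 <= n < N)%N by rewrite nE leqnn andbT -ltnS -nE.
move: (Dy); rewrite {1}/domain/= in_itv/= => /andP[y1 yN].
have [ny|/ltW ny] := leP (u n) y.
  right; exists (contr_inv u N n y).
  have Sy : subdomain u n y by rewrite /subdomain/= in_itv/= ny -nE.
  have Sn : subdomain u n (u N).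
    by rewrite /subdomain/= in_itv/= -nE lexx andbT (le_trans ny).
  have LN : contr_inv u N n (u N) = u N by rewrite {2}nE contr_inv_last.
  split; first exact: contr_inv_domain.
    by rewrite -{3}LN; exact: G_affine.
  by rewrite -{1}LN; exact: contr_inv_dist_le.
left; apply: le_trans (G_bounded Dy DN) _; rewrite ler_wpM2l//.
rewrite distrC ger0_norm ?subr_ge0//; apply: (@le_trans _ _ (u N - u n)).
  by apply: min_slope_gap => //; case/andP: nN => -> ->.
by rewrite lerD2l lerN2.
Qed.

(** One use of the functional equation moves a Lipschitz bound at a point to its
    image under a contraction. The images of [u 1] and [u N] are the nodes. *)
Lemma lipschitz_at_contr j x v : (1 <= j < N)%N ->
  subdomain u j x -> subdomain u j v ->
  (forall y, domain u N y -> mdist (G y) (G (contr_inv u N j v))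
    <= K * `|y - contr_inv u N j v|) ->
  mdist (G x) (G v) <= K * `|x - v|.
Proof.
move=> jN Sx Sv Gv; apply: le_trans (G_affine jN Sx Sv) _.
have Ex := contr_inv_dist_le x v jN.
have al0 : 0 <= al by case/andP: al01.
have h1 := ler_wpM2l al0 (Gv _ (contr_inv_domain jN Sx)).
have h2 := ler_wpM2l K0 Ex.
have h3 : (C + q * K) * `|x - v| <= K * `|x - v| by rewrite ler_wpM2r.
apply: le_trans h3; rewrite mulrDl lerD2l; apply: (le_trans h1); lra.
Qed.

Lemma lipschitz_to_right_node j x : (1 <= j < N)%N -> subdomain u j x ->
  mdist (G x) (G (u j.+1)) <= K * (u j.+1 - x).
Proof.
move=> jN Sx; move: (Sx); rewrite {1}/subdomain/= in_itv/= => /andP[jx xj].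
rewrite -[u j.+1 - x]ger0_norm ?subr_ge0// distrC.
apply: (lipschitz_at_contr jN Sx); 
  last by rewrite contr_inv_last//; exact: lipschitz_at_last.
by rewrite /subdomain/= in_itv/= lexx (le_trans jx).
Qed.

Lemma lipschitz_to_left_node j x : (1 <= j < N)%N -> subdomain u j x ->
  mdist (G (u j)) (G x) <= K * (x - u j).
Proof.
move=> jN Sx; move: (Sx); rewrite {1}/subdomain/= in_itv/= => /andP[jx xj].
rewrite metric_sym -[x - u j]ger0_norm ?subr_ge0//.
apply: (lipschitz_at_contr jN Sx); 
  last by rewrite contr_inv_first//; exact: lipschitz_at_first.
by rewrite /subdomain/= in_itv/= lexx (le_trans jx).
Qed.

(** The path from [x] to [y] goes through the node after [x] and the node before
    [y]. Each of the three steps goes to the right, so their lengths add up to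
    [|x - y|] and the constant [K] is not increased. *)
Lemma lipschitz_across_nodes i j x y : (1 <= i < j)%N -> (j < N)%N ->
  subdomain u i x -> subdomain u j y -> mdist (G x) (G y) <= K * `|x - y|.
Proof.
move=> /andP[i1 ij] jN Sx Sy.
have iN : (1 <= i < N)%N by rewrite i1 (ltn_trans ij).
have j1N : (1 <= j < N)%N by rewrite jN (leq_trans i1 (ltnW ij)).
move: (Sx) (Sy); rewrite /subdomain/= !in_itv/= => /andP[ix xi] /andP[jy yj].
have uij : u i.+1 <= u j by apply: node_le; rewrite ?ij// ltnW.
have nodes : mdist (G (u i.+1)) (G (u j)) <= K * (u j - u i.+1).
  have [<-|i1j] := eqVneq i.+1 j; first by rewrite mdistxx subrr mulr0.
  apply: le_trans (G_bounded _ _) _.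
  - by apply: domain_node; case/andP: iN.
  - by apply: domain_node; case/andP: j1N => -> /ltnW.
  rewrite ler_wpM2l//; apply: min_slope_gap; last exact: ltnW.
  by rewrite [(_ < j)%N]ltn_neqAle i1j.
have xy : x <= y by exact: le_trans xi (le_trans uij jy).
rewrite distrC ger0_norm ?subr_ge0//.
have h1 := lipschitz_to_right_node iN Sx.
have h2 := lipschitz_to_left_node j1N Sy.
have h3 := metric_triangle (G x) (G (u i.+1)) (G y).
have h4 := metric_triangle (G (u i.+1)) (G (u j)) (G y).
have -> : K * (y - x) = K * (u i.+1 - x) + K * (u j - u i.+1) + K * (y - u j).
  by ring.
lra.
Qed.

Lemma self_affine_lipschitz x y : domain u N x -> domain u N y ->
  mdist (G x) (G y) <= K * `|x - y|.
Proof.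
pose P := [set p : R * R | domain u N p.1 /\ domain u N p.2].
pose D p := mdist (G p.1) (G p.2); pose E (p : R * R) := `|p.1 - p.2|.
move=> Dx Dy.
apply: (@self_similar_bound _ _ P D E _ _ _ _
  (K * (min_slope u N * (u N - u 1%N))) al01 CK K0 _ _ _ (x, y)) => //.
- by move=> p _; exact: normr_ge0.
- by move=> p [p1 p2]; exact: G_bounded p1 p2.
- move=> [{Dx Dy}x {}y] [/= Dx Dy].
  have [i iN Sx] := domain_subdomain Dx; have [j jN Sy] := domain_subdomain Dy.
  have [ij|ji|ij] := ltngtP i j.
  + left; apply: lipschitz_across_nodes Sx Sy; last by case/andP: jN.
    by rewrite ij andbT; case/andP: iN.
  + left; rewrite /D /E/= metric_sym distrC.
    apply: lipschitz_across_nodes Sy Sx; last by case/andP: iN.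
    by rewrite ji andbT; case/andP: jN.
  + rewrite -ij in Sy; right; exists (contr_inv u N i x, contr_inv u N i y).
    split; first by split; exact: contr_inv_domain.
      exact: G_affine.
    exact: contr_inv_dist_le.
Qed.

End self_affine.
End partition.

(** The constant [C] collects the Lipschitz constants of [F] and [S]. The first
    term in [K] is the fixed point of [K = C + q * K]. *)
Lemma alpha_fractal_lipschitz (R : realType) (N : nat) (u : nat -> R)
  (F S G : R -> compacts R) (alpha : R) : (1 < N)%N ->
  (forall j, (1 <= j < N)%N -> u j < u j.+1) ->
  lipschitz_within (domain u N) F -> lipschitz_within (domain u N) S ->
  `|alpha| < 1 -> alpha_fractal u N F S alpha G ->
  `|alpha| < min_slope u N -> lipschitz_within (domain u N) G.
Proof.
move=> N1 hu /lipschitz_within_nonneg[kF kF0 FkF].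
move=> /lipschitz_within_nonneg[kS kS0 SkS] al1 [Gc Geq] al_min.
have a0 : 0 < min_slope u N by apply: le_lt_trans al_min.
have al01 : 0 <= `|alpha| < 1 by rewrite normr_ge0.
have l0 := length_gt0 N1 hu.
have u1N : u 1%N <= u N by rewrite -subr_ge0 ltW.
have [M GM] := continuous_bounded_within u1N Gc.
set q := `|alpha| / min_slope u N.
have q0 : 0 <= q by rewrite divr_ge0// ltW.
have q1 : 0 < 1 - q by rewrite subr_gt0 ltr_pdivrMr// mul1r.
set C := kF + q * kS; have C0 : 0 <= C by rewrite addr_ge0// mulr_ge0.
set K := Num.max (C / (1 - q)) (M / (min_slope u N * (u N - u 1%N))).
have KC : C / (1 - q) <= K by rewrite le_max lexx.
have KM : M / (min_slope u N * (u N - u 1%N)) <= K by rewrite le_max lexx orbT.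
have K0 : 0 <= K by apply: le_trans KC; rewrite divr_ge0// ltW.
exists K => x y; apply: (@self_affine_lipschitz _ _ _ N1 hu _ _ `|alpha| C K) => //.
- by move: KC; rewrite ler_pdivrMr// mulrBr mulr1 lerBrDr mulrC.
- move=> {}x {}y Ix Iy; apply: le_trans (GM x y Ix Iy) _.
  by rewrite -ler_pdivrMr ?mulr_gt0.
- move=> j {}x {}y jN Sx Sy.
  have Dsub z : subdomain u j z -> domain u N z.
    rewrite /subdomain /domain/= !in_itv/= => /andP[jz zj].
    case/andP: (jN) => j1 jlt.
    apply/andP; split; [apply: le_trans jz|apply: (le_trans zj)].
      by apply: (node_le hu); rewrite ?j1 ?(ltnW jlt).
    by apply: (node_le hu); rewrite ?jlt ?leqnn.
  apply: le_trans (mdist_mink (Geq j x jN Sx) (Geq j y jN Sy)) _.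
  have h1 := FkF _ _ (Dsub _ Sx) (Dsub _ Sy).
  have h2 := SkS _ _ (contr_inv_domain N1 hu jN Sx) (contr_inv_domain N1 hu jN Sy).
  have h3 := ler_wpM2l kS0 (contr_inv_dist_le N1 hu al01 al_min x y jN).
  have h4 := ler_wpM2l (normr_ge0 alpha) h2.
  by rewrite -/q in h3; rewrite /C mulrDr mulrDl; lra.
Qed.

(** * Dimension of the graph of the fractal function *)

Theorem theorem5p11 (R : realType) (N : nat) (u : nat -> R)
  (F S Falpha : R -> compacts R) (alpha : R)
  (hN : (2 < N)%N)
  (hu : forall j, (1 <= j < N)%N -> u j < u j.+1)
  (F_Kc : continuous_convex (domain u N) F)
  (S_Kc : continuous_convex (domain u N) S)
  (F_lip : lipschitz_within (domain u N) F)
  (S_lip : lipschitz_within (domain u N) S)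
  (hSF : mink_sub (S (u 1%N)) (F (u 1%N)) = mink_sub (S (u N)) (F (u N)))
  (halpha : -1 < alpha < 1)
  (hFalpha : alpha_fractal u N F S alpha Falpha) :
  `|alpha| < min_slope u N ->
  hausdorff_dim (graph (domain u N) Falpha) = 1%:E.
Proof.
move=> al_min.
have N1 : (1 < N)%N := ltnW hN.
have al1 : `|alpha| < 1 by rewrite ltr_norml.
have u1N : u 1%N < u N by rewrite -subr_gt0 (length_gt0 N1).
apply/le_anti/andP; split; last exact: graph_dim_ge1.
apply: lipschitz_graph_dim_le1 => //.
exact: alpha_fractal_lipschitz F_lip S_lip al1 hFalpha al_min.
Qed.
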